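(* For every real $x \geq 1$, let $$\hat{r}'(x)=\max\left\{r \: : \: \left( 1-\frac{x}{r},\ 1 -\frac{x+1}{r} \right) \in \mathcal{V} \right\}.$$ Then the limit $$\hat{r}(x) := \lim_{\substack{n,m \to \infty \\ n/m \to x}} \frac{r(S(n,m))}{m}$$ exists and $$\hat{r}(x) = \max(2x,\ x+2,\ \hat{r}'(x)).$$
   Context: For integers $n \geq m \geq 0$, the double star $S(n,m)$ is the union of two stars $K_{1,n}$ and $K_{1,m}$ together with an edge joining their centers; $r(H)$ is the least $N$ such that every 2-coloring of the edges of $K_N$ contains a monochromatic copy of $H$. $N(v)$ denotes the neighborhood of a vertex $v$. Given $0 \leq \delta,\eta \leq 1$, a graph $G$ with $|V(G)|>1$ is a $(\delta,\eta)$-graph if $\deg(v)+1 \geq \delta|V(G)|$ for every $v \in V(G)$ and $|N(v) \cup N(u)| \leq (1 -\eta)|V(G)|$ for all $uv \in E(G)$. A point $(\delta,\eta) \in [0,1]^2$ is directly valid if there exists a $(\delta,\eta)$-graph, and valid if it lies in the closure of the set of directly valid points. $\mathcal{V} \subseteq [0,1]^2$ is the set of valid points. *)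

(* Defs.v *)
From HB Require Import structures.
From mathcomp Require Import all_boot all_order all_algebra.
From mathcomp Require Import zify.

Set Implicit Arguments.
Unset Strict Implicit.
Unset Printing Implicit Defensive.

Import Order.TTheory GRing.Theory Num.Theory.


Record sgraph := SGraph {
  vertex :> finType;
  adj : rel vertex;
  adj_sym : symmetric adj;
  adj_irr : irreflexive adj }.

Definition neighborhood (G : sgraph) (v : G) : {set G} := [set u | adj v u].

Section DoubleStar.
Variables n m : nat.

(* The star K_{1,k} lives on [option 'I_k], with centre [None]. *)
Definition star_adj k : rel (option 'I_k) := fun u v => isSome u != isSome v.

Definition double_star_adj : rel (option 'I_n + option 'I_m) := fun u v =>
  match u, v with
  | inl a, inl b => star_adj a b
  | inr a, inr b => star_adj a b
  | inl a, inr b => (a == None) && (b == None)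
  | inr b, inl a => (a == None) && (b == None)
  end.

Lemma double_star_adj_sym : symmetric double_star_adj.
Proof. by move=> [a|a] [b|b] //=; rewrite /star_adj eq_sym. Qed.

Lemma double_star_adj_irr : irreflexive double_star_adj.
Proof. by move=> [a|a] /=; rewrite /star_adj eqxx. Qed.

Definition double_star := SGraph double_star_adj_sym double_star_adj_irr.

End DoubleStar.

(* A 2-colouring of the edges of K_N is a function on subsets of 'I_N, of which
   only the values at 2-element subsets matter. *)
Definition mono_copy (H : sgraph) (N : nat) (c : {ffun {set 'I_N} -> bool}) :=
  [exists f : {ffun H -> 'I_N}, injectiveb f &&
    [exists b : bool, forall u : H, forall v : H,
      adj u v ==> (c [set f u; f v] == b)]].

Definition arrows (H : sgraph) (N : nat) : bool :=
  [forall c : {ffun {set 'I_N} -> bool}, mono_copy H c].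

Lemma ramsey_clique (T : finType) (c : {set T} -> bool) (p q : nat)
    (A : {set T}) : (2 ^ (p + q) <= #|A|)%N ->
  exists (b : bool) (B : {set T}), [/\ B \subset A,
    #|B| = (if b then p else q) &
    {in B &, forall u v, u != v -> c [set u; v] = b}].
Proof.
have [k] := ubnP (p + q)%N; elim: k p q A => // k IHk [|p] [|q] A lt_pq leA.
1-2: exists true, set0.
1-2: by split; rewrite ?sub0set ?cards0 // => u v; rewrite inE.
  exists false, set0.
  by split; rewrite ?sub0set ?cards0 // => u v; rewrite inE.
have /card_gt0P[x xA] : (0 < #|A|)%N by apply: leq_trans leA; rewrite expn_gt0.
pose S (b : bool) := [set y in A :\ x | c [set x; y] == b].
have SA b : S b \subset A.
  by apply/subsetP => y; rewrite !inE => /andP[/andP[_ ->]].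
have xS b : x \notin S b by rewrite !inE eqxx.
have cardS : (#|S true| + #|S false| = #|A|.-1)%N.
  rewrite -cardsUI (_ : S true :&: S false = set0).
    rewrite cards0 addn0 (cardsD1 x A) xA /=; apply: eq_card => y.
    by rewrite !inE -andb_orr; case: (c _); rewrite andbT.
  by apply/setP => y; rewrite !inE; case: (c _); rewrite ?andbF.
have ext b (B : {set T}) : B \subset S b ->
    {in B &, forall u v, u != v -> c [set u; v] = b} ->
    {in x |: B &, forall u v, u != v -> c [set u; v] = b}.
  move=> /subsetP BS Bb u v /setU1P[->|uB] /setU1P[->|vB] // uv.
  - by rewrite eqxx in uv.
  - by have := BS _ vB; rewrite !inE => /andP[_ /eqP].
  - by rewrite setUC; have := BS _ uB; rewrite !inE => /andP[_ /eqP].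
  - exact: Bb.
have [leT|ltT] := leqP (2 ^ (p + q.+1)) #|S true|.
  have [|b [B [BS cB Bb]]] := IHk p q.+1 (S true) _ leT.
    by rewrite ltnS in lt_pq.
  case: b cB Bb => cB Bb; last first.
    by exists false, B; split=> //; exact: subset_trans BS (SA _).
  exists true, (x |: B); split; last exact: ext.
    by rewrite subUset sub1set xA (subset_trans BS (SA _)).
  by rewrite cardsU1 cB (contra (subsetP BS x) (xS _)).
have leF : (2 ^ (p.+1 + q) <= #|S false|)%N.
  move: leA ltT cardS; rewrite -!addSnnS !addSn !expnS.
  have : (0 < 2 ^ (p + q))%N by rewrite expn_gt0.
  by lia.
have [|b [B [BS cB Bb]]] := IHk p.+1 q (S false) _ leF.
  by rewrite addnS ltnS in lt_pq.
case: b cB Bb => cB Bb.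
  by exists true, B; split=> //; exact: subset_trans BS (SA _).
exists false, (x |: B); split; last exact: ext.
  by rewrite subUset sub1set xA (subset_trans BS (SA _)).
by rewrite cardsU1 cB (contra (subsetP BS x) (xS _)).
Qed.

Lemma arrows_exists (H : sgraph) : exists N, arrows H N.
Proof.
exists (2 ^ (#|H| + #|H|))%N; apply/forallP => c.
have [|b [B [_ cB Bb]]] := @ramsey_clique _ c #|H| #|H|
    [set: 'I_(2 ^ (#|H| + #|H|))].
  by rewrite cardsT card_ord.
have {}cB : #|H| = #|B| by rewrite cB if_same.
pose f : {ffun H -> _} := [ffun u => enum_val (cast_ord cB (enum_rank u))].
have f_inj : injective f.
  move=> u v; rewrite !ffunE => /enum_val_inj /cast_ord_inj.
  exact: enum_rank_inj.
apply/existsP; exists f; apply/andP; split; first exact/injectiveP.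
apply/existsP; exists b; apply/forallP => u; apply/forallP => v.
apply/implyP => uv; apply/eqP/Bb; rewrite ?ffunE ?enum_valP //.
by rewrite -!(ffunE (fun u => enum_val (cast_ord cB (enum_rank u))))
  (inj_eq f_inj); apply: contraTneq uv => ->; rewrite adj_irr.
Qed.

Definition ramsey (H : sgraph) : nat := ex_minn (arrows_exists H).

From mathcomp Require Import all_classical all_reals all_analysis.
Import numFieldNormedType.Exports.

Local Open Scope classical_set_scope.
Local Open Scope ring_scope.

Section Valid.
Variable R : realType.

Definition delta_eta_graph (delta eta : R) (G : sgraph) : Prop :=
  [/\ (1 < #|G|)%N,
      forall v : G, delta * #|G|%:R <= #|neighborhood v|%:R + 1 &
      forall u v : G, adj u v ->
        #|(neighborhood v :|: neighborhood u)%SET|%:R <= (1 - eta) * #|G|%:R].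

Definition directly_valid : set (R * R) :=
  [set p | [/\ 0 <= p.1 <= 1, 0 <= p.2 <= 1 &
               exists G : sgraph, delta_eta_graph p.1 p.2 G]].

Definition valid : set (R * R) := closure directly_valid.

(* Real division by 0 is undefined, whereas here it returns 0: hence [r != 0]. *)
Definition rhat'_set (x : R) : set R :=
  [set r | r != 0 /\ valid (1 - x / r, 1 - (x + 1) / r)].

Definition is_max (A : set R) (a : R) : Prop := A a /\ ubound A a.

(* The filter "n, m --> oo and n / m --> x" on the pairs (n, m) with n >= m. *)
Definition ratio_to (x : R) : set_system (nat * nat) :=
  [set A | exists2 e : R, 0 < e &
    \forall p \near filter_prod \oo \oo,
      (p.2 <= p.1)%N -> `|p.1%:R / p.2%:R - x| < e -> A p].

Global Instance ratio_to_filter x : Filter (ratio_to x).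
Proof.
split.
- by exists 1 => //; apply: nearW.
- move=> A B [d d0 dA] [e e0 eB]; exists (Num.min d e).
    by rewrite lt_min d0.
  apply: filterS2 dA eB => p Ap Bp le_p.
  by rewrite lt_min => /andP[/(Ap le_p) ? /(Bp le_p)].
- move=> A B AB [e e0 eA]; exists e => //.
  by apply: filterS eA => p Ap le_p /(Ap le_p)/AB.
Qed.

Lemma ratio_to_proper x : 1 <= x -> ProperFilter (ratio_to x).
Proof.
move=> x1; apply: Build_ProperFilter_ex => A [e e0 [[P Q] [[a _ aP] [b _ bQ]] PQ]].
pose m := (a + b + (Num.truncn e^-1).+1)%N.
pose n := (Num.truncn (m%:R * x)).+1.
have x0 : 0 < x by apply: lt_le_trans x1.
have m0 : 0 < m%:R :> R by rewrite ltr0n /m addnS.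
have mx0 : 0 <= m%:R * x by rewrite mulr_ge0 ?ltW.
have /andP[n1 n2] := truncn_itv mx0.
have mn : (m <= n)%N.
  rewrite -(ler_nat R); apply: le_trans (ltW n2).
  by rewrite ler_peMr // ltW.
exists (n, m); apply: (PQ (n, m)) => //=.
  split=> /=; [apply: aP|apply: bQ] => /=; last by rewrite /m; lia.
  by apply: leq_trans mn; rewrite /m; lia.
have -> : n%:R / m%:R - x = (n%:R - m%:R * x) / m%:R.
  by rewrite mulrBl mulrAC mulfV ?gt_eqF // mul1r.
rewrite ger0_norm; last by rewrite divr_ge0 ?subr_ge0 ?ltW.
rewrite ltr_pdivrMr //; apply: (@le_lt_trans _ _ 1).
  by rewrite lerBlDr /n -natr1 addrC lerD2l.
rewrite -ltr_pdivrMl // mulr1.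
have ei0 : 0 <= e^-1 by rewrite invr_ge0 ltW.
have /andP[_ h] := truncn_itv ei0; apply: lt_le_trans h _.
by rewrite ler_nat /m leq_addl.
Qed.

End Valid.

(* Main.v *)
Require Import Defs.
From mathcomp Require Import all_boot all_order all_algebra.
From mathcomp Require Import zify ring lra.

Set Implicit Arguments.
Unset Strict Implicit.
Unset Printing Implicit Defensive.

Import Order.TTheory GRing.Theory Num.Theory.

(** The lower bounds come from explicit colourings of [K_N]: two cliques of size
    [n], two cliques of sizes [n + m + 1] and [m], and the blow-up of a
    (delta, eta)-graph with every vertex replaced by a clique.

    For the upper bound, let [N >= max(2n + 2, n + 2m + 2)] and let a colouring
    avoid S(n, m).  Then all degrees in both colours exceed [m], so the
    endpoints [u], [v] of a red edge at a vertex of red degree [> n] have at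
    most [n + m + 1] red neighbours together, and likewise for blue.  Write
    [e u v] for the sign (1 red, -1 blue, 0 on the diagonal) of [uv] and [S u]
    for the row sums of [e].  If [V] splits into nonempty parts [A], [B] with
    red degrees [> n] on [A] and blue degrees [> n] on [B], each pair [a], [b]
    satisfies
      [\sum_z e a z * e b z - e a b * (S a + S b) >= 3N - 4(n + m + 1) > 0],
    but the sum of the left-hand side over [A * B] is minus a sum of squares.
    Hence one colour has maximum degree at most [n], and the other colour is a
    (1 - n/N, 1 - (n + m + 1)/N)-graph. *)

(** * Colourings without a monochromatic double star *)

(** Excluding [v] makes the diagonal of [g] irrelevant, so [g] may be reflexive, as for membership
    in a common clique. *)
Definition colour_nbhd (T : finType) (g : rel T) (b : bool) (v : T) : {set T} :=
  [set u | (u != v) && (g v u == b)].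

(** Counting form of the absence of S(n, m): each centre counts the other among its neighbours,
    whence the strict bounds, and a copy has [n + m + 2] vertices, all in the union. By Hall's
    condition for two leaf sets nothing more is needed to build a copy. *)
Definition avoids (T : finType) (g : rel T) (n m : nat) : Prop :=
  forall b u v, v \in colour_nbhd g b u ->
    n < #|colour_nbhd g b u| -> m < #|colour_nbhd g b v| ->
    #|colour_nbhd g b u :|: colour_nbhd g b v| <= n + m + 1.

Lemma card_colour_nbhd (T : finType) (g : rel T) b v :
  #|colour_nbhd g b v| + #|colour_nbhd g (~~ b) v| + 1 = #|T|.
Proof.
have <- : #|[set~ v]| + 1 = #|T|.
  by rewrite addn1 cardsC1 prednK //; apply/card_gt0P; exists v.
congr (_ + 1); rewrite -cardsUI (_ : _ :&: _ = set0) ?cards0 ?addn0.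
  apply: eq_card => u; rewrite !inE -andb_orr.
  by case: (g v u); case: b; rewrite /= ?andbT.
by apply/setP => u; rewrite !inE; case: (g v u); case: b; rewrite ?andbF.
Qed.

Lemma colour_nbhd_sym (T : finType) (g : rel T) (g_sym : symmetric g) b u v :
  (u \in colour_nbhd g b v) = (v \in colour_nbhd g b u).
Proof. by rewrite !inE eq_sym g_sym. Qed.

Lemma avoids_no_embedding (T : finType) (g : rel T) n m b
    (f : double_star n m -> T) :
  avoids g n m -> injective f ->
  (forall u v, adj u v -> g (f u) (f v) = b) -> False.
Proof.
move=> avg finj fadj.
pose c1 : double_star n m := inl None; pose c2 : double_star n m := inr None.
have nbf (u v : double_star n m) : adj u v -> f v \in colour_nbhd g b (f u).
  move=> uv; rewrite inE fadj // eqxx andbT (inj_eq finj).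
  by apply: contraTneq uv => ->; rewrite adj_irr.
have card_le (U : finType) (h : U -> double_star n m) (A : {set T}) :
    injective h -> (forall i, f (h i) \in A) -> #|U| <= #|A|.
  move=> hinj hA; rewrite -(card_codom (inj_comp finj hinj)).
  by apply/subset_leq_card/subsetP => y /codomP[i ->]; exact: hA.
have d1 : n < #|colour_nbhd g b (f c1)|.
  rewrite -{1}[n]card_ord -card_option.
  apply: (@card_le _ (fun i => if i is Some j then inl (Some j) else c2)).
    by move=> [i|] [j|] //= [->].
  by move=> [i|]; exact: nbf.
have d2 : m < #|colour_nbhd g b (f c2)|.
  rewrite -{1}[m]card_ord -card_option.
  apply: (@card_le _ (fun i => if i is Some j then inr (Some j) else c1)).
    by move=> [i|] [j|] //= [->].
  by move=> [i|]; exact: nbf.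
have : #|{: double_star n m}| <=
    #|colour_nbhd g b (f c1) :|: colour_nbhd g b (f c2)|.
  apply: (@card_le _ id) => // -[[i|]|[i|]]; rewrite in_setU.
  - by rewrite nbf.
  - by rewrite [X in _ || X]nbf ?orbT.
  - by rewrite [X in _ || X]nbf ?orbT.
  - by rewrite nbf.
have a12 : adj c1 c2 by [].
have := avg b (f c1) (f c2) (nbf _ _ a12) d1 d2.
by rewrite card_sum !card_option !card_ord; lia.
Qed.

Lemma avoids_lt_ramsey (T : finType) (g : rel T) n m :
  symmetric g -> avoids g n m -> #|T| < ramsey (double_star n m).
Proof.
move=> gsym avg; rewrite /ramsey; case: ex_minnP => N /forallP arrN _.
rewrite ltnNge; apply/negP => leN.
pose h (i : 'I_N) : T := enum_val (widen_ord leN i).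
have hinj : injective h.
  by move=> i j /enum_val_inj /(congr1 val) /= ij; apply: val_inj.
(* The colouring of pairs induced by [g]; symmetry makes the choice of order in the pair
   harmless. *)
pose c := [ffun s : {set 'I_N} =>
  [exists i, exists j, (s == [set i; j]) && g (h i) (h j)]].
have cE i j : c [set i; j] = g (h i) (h j).
  rewrite ffunE; apply/existsP/idP => [[i' /existsP[j' /andP[/eqP ij gij]]]|gij].
    have : i \in [set i'; j'] by rewrite -ij set21.
    have : j \in [set i'; j'] by rewrite -ij set22.
    have : i' \in [set i; j] by rewrite ij set21.
    have : j' \in [set i; j] by rewrite ij set22.
    rewrite !inE => /orP[]/eqP ? /orP[]/eqP ? /orP[]/eqP ? /orP[]/eqP ?;
      by subst; rewrite // gsym.
  by exists i; apply/existsP; exists j; rewrite eqxx.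
have /existsP[f /andP[/injectiveP finj /existsP[b /forallP fb]]] := arrN c.
apply: (avoids_no_embedding (b := b) avg (inj_comp hinj finj)) => u v uv /=.
by have /forallP/(_ v)/implyP/(_ uv)/eqP <- := fb u; rewrite cE.
Qed.

Lemma subset_of_card (T : finType) (A C : {set T}) k :
  A \subset C -> #|A| <= k <= #|C| ->
  exists B : {set T}, [/\ A \subset B, B \subset C & #|B| = k].
Proof.
move=> AC /andP[/subnKC <-]; elim: (k - #|A|)%N => [|d IHd] leC.
  by exists A; rewrite subxx addn0.
have [|B [AB BC cB]] := IHd; first by lia.
have /card_gt0P[x] : 0 < #|C :\: B|.
  by rewrite cardsD (setIidPr BC) cB; lia.
rewrite inE => /andP[xB xC]; exists (x |: B); split.
- exact: subset_trans AB (subsetU1 _ _).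
- by rewrite subUset sub1set xC.
- by rewrite cardsU1 xB cB; lia.
Qed.

(** Hall's condition for two sets: [L] takes points outside [Y] first, so as few points of [Y] as
    possible are lost for [M]. *)
Lemma disjoint_subsets_of_card (T : finType) (X Y : {set T}) n m :
  n <= #|X| -> m <= #|Y| -> n + m <= #|X :|: Y| ->
  exists L M : {set T}, [/\ L \subset X, M \subset Y, [disjoint L & M],
    #|L| = n & #|M| = m].
Proof.
move=> leX leY leXY.
have [L [LX cL leM]] :
    exists L : {set T}, [/\ L \subset X, #|L| = n & m <= #|Y :\: L|].
  have [le_n|lt_n] := leqP n #|X :\: Y|.
    have [|L [_ LXY cL]] := @subset_of_card _ set0 (X :\: Y) n (sub0set _).
      by rewrite cards0.
    have /subsetDP[LX dLY] := LXY.
    exists L; split=> //; rewrite (setDidPl _) 1?disjoint_sym //.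
  have [|L [XYL LX cL]] := @subset_of_card _ (X :\: Y) X n (subsetDl _ _).
    by rewrite ltnW.
  exists L; split=> //; have := leXY.
  have -> : X :|: Y = L :|: (Y :\: L).
    apply/setP => z; have /subsetP/(_ z) := XYL; have /subsetP/(_ z) := LX.
    rewrite !inE; case: (z \in L); case: (z \in X); case: (z \in Y) => //=.
    + by move=> /(_ isT).
    + by move=> _ /(_ isT).
  by rewrite cardsU; lia.
have [|M [_ MYL cM]] := @subset_of_card _ set0 (Y :\: L) m (sub0set _).
  by rewrite cards0.
have /subsetDP[MY dML] := MYL.
by exists L, M; rewrite disjoint_sym.
Qed.

Lemma not_arrows_avoids n m N : ~~ arrows (double_star n m) N ->
  exists2 g : rel 'I_N, symmetric g & avoids g n m.
Proof.
rewrite negb_forall => /existsP[c noc].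
pose g : rel 'I_N := fun u v => c [set u; v].
have gsym : symmetric g by move=> i j; rewrite /g setUC.
exists g => // b u v uv du dv; rewrite leqNgt; apply: contraNN noc => leU.
have vu : u \in colour_nbhd g b v by rewrite colour_nbhd_sym.
have vneu : v != u by move: uv; rewrite inE => /andP[].
(* Leaves must differ from both centres: each neighbourhood loses one point and the union loses two,
   leaving exactly the required sizes [n], [m] and [n + m]. *)
have [||| L [M [/subsetP LX /subsetP MY dLM cL cM]]] :=
  @disjoint_subsets_of_card _
  (colour_nbhd g b u :\ v) (colour_nbhd g b v :\ u) n m.
- by rewrite (cardsD1 v) uv in du.
- by rewrite (cardsD1 u) vu in dv.
- have -> : (colour_nbhd g b u :\ v) :|: (colour_nbhd g b v :\ u) =
      (colour_nbhd g b u :|: colour_nbhd g b v) :\ u :\ v.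
    apply/setP => z; rewrite !inE.
    by case: (z == u); case: (z == v).
  move: leU; rewrite (cardsD1 u) (cardsD1 v (_ :\ u)) in_setU vu orbT.
  by rewrite in_setD1 in_setU uv vneu /= !add1n addn1 !ltnS.
pose f : {ffun double_star n m -> 'I_N} := [ffun w => match w with
  | inl None => u | inr None => v
  | inl (Some i) => enum_val (cast_ord (esym cL) i)
  | inr (Some i) => enum_val (cast_ord (esym cM) i) end].
have inL i : f (inl (Some i)) \in L by rewrite ffunE enum_valP.
have inM i : f (inr (Some i)) \in M by rewrite ffunE enum_valP.
have nbL i : f (inl (Some i)) \in colour_nbhd g b u.
  by have := LX _ (inL i); rewrite in_setD1 => /andP[].
have nbM i : f (inr (Some i)) \in colour_nbhd g b v.
  by have := MY _ (inM i); rewrite in_setD1 => /andP[].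
have fu : f (inl None) = u by rewrite ffunE.
have fv : f (inr None) = v by rewrite ffunE.
have Lu i : f (inl (Some i)) != u by have := nbL i; rewrite inE => /andP[].
have Mv i : f (inr (Some i)) != v by have := nbM i; rewrite inE => /andP[].
have Lv i : f (inl (Some i)) != v.
  by have := LX _ (inL i); rewrite in_setD1 => /andP[].
have Mu i : f (inr (Some i)) != u.
  by have := MY _ (inM i); rewrite in_setD1 => /andP[].
have LM i j : f (inl (Some i)) != f (inr (Some j)).
  apply: contraTneq (inM j) => <-.
  by rewrite (disjointFr dLM (inL i)).
have finj : injective f.
  move=> [[i|]|[i|]] [[j|]|[j|]] //; rewrite ?fu ?fv => /eqP.
  - by rewrite !ffunE => /eqP /enum_val_inj /cast_ord_inj ->.
  - by rewrite (negPf (Lu _)).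
  - by rewrite (negPf (LM _ _)).
  - by rewrite (negPf (Lv _)).
  - by rewrite eq_sym (negPf (Lu _)).
  - by rewrite eq_sym (negPf (Mu _)).
  - by rewrite eq_sym (negPf vneu).
  - by rewrite eq_sym (negPf (LM _ _)).
  - by rewrite (negPf (Mu _)).
  - by rewrite !ffunE => /eqP /enum_val_inj /cast_ord_inj ->.
  - by rewrite (negPf (Mv _)).
  - by rewrite eq_sym (negPf (Lv _)).
  - by rewrite (negPf vneu).
  - by rewrite eq_sym (negPf (Mv _)).
apply/existsP; exists f; apply/andP; split; first exact/injectiveP.
apply/existsP; exists b; apply/forallP => w1; apply/forallP => w2.
have gE w z : w \in colour_nbhd g b z -> c [set z; w] == b.
  by rewrite inE => /andP[].
apply/implyP; case: w1 w2 => [[i|]|[i|]] [[j|]|[j|]] //= _; rewrite ?fu ?fv.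
- by rewrite setUC; apply: gE.
- exact: gE.
- exact: gE.
- by rewrite setUC; apply: gE.
- exact: gE.
- exact: gE.
Qed.

(** * Degrees in a colouring without a monochromatic double star *)

Section AvoidingColourings.
Variables (T : finType) (g : rel T) (n m : nat).
Hypotheses (g_sym : symmetric g) (avg : avoids g n m).
Let N := #|T|.
Let nb := colour_nbhd g.

(** If [w] had more than [m] neighbours, the edge [uw] would be forbidden: the union contains
    [nb b u] and also [u], at least [n + m + 2] points. *)
Lemma large_degree_neighbour b u w : n + m < #|nb b u| -> w \in nb b u ->
  #|nb b w| <= m.
Proof.
move=> du uw; rewrite leqNgt; apply/negP => dw.
have ltn : n < #|nb b u| by apply: leq_ltn_trans du; exact: leq_addr.
have := avg uw ltn dw; rewrite leqNgt => /negP; apply.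
have uNu : u \notin nb b u by rewrite inE eqxx.
have := subset_leq_card (A := u |: nb b u) (B := nb b u :|: nb b w).
rewrite cardsU1 uNu => leU.
have {}leU : 1 + #|nb b u| <= #|nb b u :|: nb b w|.
  apply: leU; rewrite subUset sub1set subsetUl andbT in_setU.
  by rewrite [X in _ || X]colour_nbhd_sym // uw orbT.
by apply: leq_trans leU; rewrite addn1 add1n ltnS.
Qed.

(** If [v] has few [b]-neighbours, then by [large_degree_neighbour] all its neighbours in the other
    colour have more than [n + m] [b]-neighbours. Two of these joined in colour [b] contradict the
    same lemma. *)
Lemma avoids_min_degree b v : 0 < n -> n + 2 * m + 2 <= N -> m < #|nb b v|.
Proof.
move=> n0 leN; rewrite ltnNge; apply/negP => dv.
have large b' w : #|nb b' w| <= m -> n + m < #|nb (~~ b') w|.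
  by move: (card_colour_nbhd g b' w) leN; rewrite /nb /N; lia.
have W_large w : w \in nb (~~ b) v -> n + m < #|nb b w|.
  move=> /(large_degree_neighbour (large _ _ dv)) /large.
  by rewrite negbK.
have /card_gt0P[w vw] : 0 < #|nb (~~ b) v|.
  by have := large _ _ dv; lia.
have dw := large_degree_neighbour (large _ _ dv) vw.
have /card_gt0P[w'] : 0 < #|nb (~~ b) v :\: (w |: nb (~~ b) w)|.
  rewrite cardsD subn_gt0; apply: leq_ltn_trans (large _ _ dv).
  apply: leq_trans (subset_leq_card (subsetIr _ _)) _.
  by rewrite cardsU1; case: (_ \notin _); move: dw n0; rewrite /nb; lia.
rewrite in_setD in_setU1 negb_or => /andP[/andP[w'w ww'] vw'].
have bw' : w' \in nb b w.
  move: ww'; rewrite !inE w'w /=.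
  by case: (g w w'); case: b {dv large W_large vw dw vw'}.
have := large_degree_neighbour (W_large _ vw) bw'.
by have := W_large _ vw'; lia.
Qed.

Local Open Scope ring_scope.

Let e (u v : T) : int := if u == v then 0 else if g u v then 1 else -1.

Let e_sym u v : e u v = e v u. Proof. by rewrite /e eq_sym g_sym. Qed.

(** Pointwise count: a vertex outside the union contributes 3, every vertex of the union, [u] and
    [v] included, contributes -1. *)
Lemma signed_codegree b u v : v \in nb b u ->
  \sum_z e u z * e v z - e u v * (\sum_z e u z + \sum_z e v z) =
  3 * N%:R - 4 * #|nb b u :|: nb b v|%:R.
Proof.
move=> uv; rewrite -big_split mulr_sumr -sumrB.
have /andP[/negPf vu /eqP guv] : (v != u) && (g u v == b).
  by rewrite inE in uv.
have uv' : (u == v) = false by rewrite eq_sym.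
have euv : e u v = if b then 1 else -1 by rewrite /e uv' guv.
transitivity (\sum_z (4 * (z \notin nb b u :|: nb b v)%:R - 1 : int)).
  apply: eq_bigr => z _ /=; rewrite euv !inE negb_or.
  have [->|/negPf zu] := eqVneq z u.
    by rewrite (e_sym v) euv /e !eqxx uv' g_sym guv eqxx; case: (b).
  have [->|/negPf zv] := eqVneq z v.
    by rewrite euv /e !eqxx ?vu guv eqxx; case: (b).
  rewrite /e ?[_ == z]eq_sym ?zu ?zv.
  by case: (g u z); case: (g v z); case: (b).
rewrite sumrB sumr_const -mulr_sumr -natr_sum.
have -> : (\sum_z (z \notin nb b u :|: nb b v) = #|~: (nb b u :|: nb b v)|)%N.
  rewrite -sum1_card [RHS]big_mkcond /=; apply: eq_bigr => z _.
  by rewrite in_setC; case: (_ \in _).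
rewrite /N -(cardsC (nb b u :|: nb b v)) natrD; ring.
Qed.

Lemma mixed_colouring_trivial (A : {set T}) :
  (forall b, forall v, (m < #|nb b v|)%N) ->
  (4 * (n + m + 1) < 3 * N)%N ->
  {in A, forall v, (n < #|nb true v|)%N} ->
  {in ~: A, forall v, (n < #|nb false v|)%N} ->
  A = set0 \/ A = setT.
Proof.
move=> mind leN Atrue Afalse.
have [->|A0] := eqVneq A set0; first by left.
have [AC0|AC0] := eqVneq (~: A) set0.
  by right; rewrite -[A]setCK AC0 setC0.
exfalso.
pose S v := \sum_z e v z.
have gt0 a b : a \in A -> b \in ~: A ->
    0 < \sum_z e a z * e b z - e a b * (S a + S b).
  move=> aA bA.
  have ba : b != a by apply: contraTneq bA => ->; rewrite inE aA.
  have : b \in nb (g a b) a by rewrite inE ba eqxx.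
  have := signed_codegree (b := g a b) (u := a) (v := b).
  move=> /[apply] ->.
  have ab : b \in nb (g a b) a by rewrite inE ba eqxx.
  have : (#|nb (g a b) a :|: nb (g a b) b| <= n + m + 1)%N.
    (* On a red edge [a] serves as the centre of degree above [n], on a blue edge [b] does; the
       other centre only needs [mind]. *)
    case gab: (g a b) in ab *; first exact: avg (Atrue _ aA) (mind _ _).
    rewrite setUC; apply: avg (Afalse _ bA) (mind _ _).
    by rewrite -/nb colour_nbhd_sym.
  by rewrite /N in leN *; lia.
(* With [S = dA + dB], the sum over [A * ~: A] collapses to
   [- \sum_(a in A) dB a ^+ 2 - \sum_(b in ~: A) dA b ^+ 2]. *)
pose dA z := \sum_(a in A) e z a; pose dB z := \sum_(b in ~: A) e z b.
have SE z : S z = dA z + dB z.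
  rewrite /S (bigID (mem A)) /=; congr (_ + _).
  by apply: eq_bigl => y; rewrite inE.
have : 0 < \sum_(a in A) \sum_(b in ~: A)
    (\sum_z e a z * e b z - e a b * (S a + S b)).
  have /set0Pn[a aA] := A0; have /set0Pn[b bA] := AC0.
  rewrite (bigD1 a aA) (bigD1 b bA) /= ltr_pwDl ?sumr_ge0 //.
    apply: ltr_pwDl; first exact: gt0.
    by apply: sumr_ge0 => b' /andP[? _]; apply/ltW/gt0.
  move=> a' /andP[? _]; apply: sumr_ge0 => b' ?; exact/ltW/gt0.
have -> : \sum_(a in A) \sum_(b in ~: A)
    (\sum_z e a z * e b z - e a b * (S a + S b)) =
    \sum_z dA z * dB z - \sum_(a in A) S a * dB a - \sum_(b in ~: A) S b * dA b.
  have -> : \sum_z dA z * dB z =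
      \sum_(a in A) \sum_(b in ~: A) \sum_z e a z * e b z.
    under [RHS]eq_bigr do rewrite exchange_big /=.
    rewrite exchange_big /=; apply: eq_bigr => z _.
    rewrite big_distrlr /=; apply: eq_bigr => a _; apply: eq_bigr => b _.
    by rewrite (e_sym z a) (e_sym z b).
  have -> : \sum_(a in A) S a * dB a =
      \sum_(a in A) \sum_(b in ~: A) S a * e a b.
    by apply: eq_bigr => a _; rewrite mulr_sumr.
  have -> : \sum_(b in ~: A) S b * dA b =
      \sum_(a in A) \sum_(b in ~: A) S b * e a b.
    rewrite exchange_big /=; apply: eq_bigr => b _; rewrite mulr_sumr.
    by apply: eq_bigr => a _; rewrite e_sym.
  rewrite -!sumrB; apply: eq_bigr => a _; rewrite -!sumrB.
  by apply: eq_bigr => b _; ring.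
rewrite (bigID (mem A)) /= ltNge => /negP; apply.
have -> : \sum_(i | i \notin A) dA i * dB i = \sum_(i in ~: A) dA i * dB i.
  by apply: eq_bigl => y; rewrite inE.
rewrite (_ : _ - _ - _ = - (\sum_(a in A) dB a ^+ 2) -
    \sum_(b in ~: A) dA b ^+ 2).
  by rewrite -opprD oppr_le0 addr_ge0 // sumr_ge0 // => *; exact: sqr_ge0.
have -> : \sum_(a in A) S a * dB a =
    \sum_(a in A) dA a * dB a + \sum_(a in A) dB a ^+ 2.
  by rewrite -big_split; apply: eq_bigr => z _; rewrite SE mulrDl expr2.
have -> : \sum_(b in ~: A) S b * dA b =
    \sum_(b in ~: A) dA b * dB b + \sum_(b in ~: A) dA b ^+ 2.
  by rewrite -big_split; apply: eq_bigr => z _; rewrite SE /=; ring.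
ring.
Qed.

Lemma avoids_max_degree : (0 < n)%N -> (2 * n + 2 <= N)%N ->
  (n + 2 * m + 2 <= N)%N -> exists b, forall v, (#|nb (~~ b) v| <= n)%N.
Proof.
move=> n0 leN1 leN2.
have mind b v : (m < #|nb b v|)%N by exact: avoids_min_degree.
(* The first bound plus twice the second gives [3 * N >= 4 * n + 4 * m + 6]. *)
have leN3 : (4 * (n + m + 1) < 3 * N)%N by lia.
have dE v : (#|nb true v| + #|nb false v| + 1 = N)%N by exact: card_colour_nbhd.
have triv := mixed_colouring_trivial mind leN3.
pose A b := [set v | (n < #|nb b v|)%N].
have A_large b : {in A b, forall v, (n < #|nb b v|)%N} by move=> v; rewrite inE.
have [||A10|A1T] := triv (A true); first exact: A_large.
- by move=> v; rewrite !inE; have := dE v; lia.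
- exists false => v; rewrite leqNgt; apply/negP => dv.
  by have := in_set0 v; rewrite -A10 inE dv.
have [||A20|A2T] := triv (~: A false).
- by move=> v; rewrite !inE; have := dE v; lia.
- by rewrite setCK; exact: A_large.
- have /card_gt0P[v _] : (0 < N)%N by lia.
  (* Here every vertex has degree above [n] in both colours, so any set may play the role of [A]; a
     singleton is neither empty nor full. *)
  have [||A0|AT] := triv [set v].
  + by move=> w _; apply: A_large; rewrite A1T.
  + move=> w _; apply: A_large.
    by rewrite -[A false]setCK A20 setC0.
  + by have := set11 v; rewrite A0 inE.
  + have := congr1 (fun X : {set T} => #|X|) AT; rewrite cards1 cardsT -/N.
    lia.
exists true => v; rewrite leqNgt; apply/negP => dv.
by have := in_setT v; rewrite -A2T !inE dv.
Qed.

End AvoidingColourings.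

(** * One colour class as a graph *)

Section ColourGraph.
Variables (T : finType) (g : rel T) (b : bool).
Hypothesis g_sym : symmetric g.

Let colour_adj : rel T := fun u v => v \in colour_nbhd g b u.

Fact colour_adj_sym : symmetric colour_adj.
Proof. by move=> u v; rewrite /colour_adj colour_nbhd_sym. Qed.

Fact colour_adj_irr : irreflexive colour_adj.
Proof. by move=> u; rewrite /colour_adj inE eqxx. Qed.

Definition colour_graph := SGraph colour_adj_sym colour_adj_irr.

Lemma neighborhood_colour_graph (v : colour_graph) :
  neighborhood v = colour_nbhd g b v.
Proof. by apply/setP => u; rewrite [LHS]inE. Qed.

End ColourGraph.

Lemma card_neighborhoodU (G : sgraph) (u v : G) : adj u v ->
  #|neighborhood v| < #|neighborhood u :|: neighborhood v|.
Proof.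
move=> uv; have vN : v \notin neighborhood v by rewrite inE adj_irr.
have -> : #|neighborhood v|.+1 = #|v |: neighborhood v|.
  by rewrite cardsU1 vN.
by apply/subset_leq_card; rewrite setSU // sub1set inE.
Qed.

(** * Lower bound constructions *)

(** With two cliques of size [n], no vertex has degree above [n] in either colour. *)
Lemma ramsey_double_star_gt_2n n m : 2 * n < ramsey (double_star n m).
Proof.
pose g : rel (bool * 'I_n) := fun u v => u.1 == v.1.
have -> : 2 * n = #|{: bool * 'I_n}| by rewrite card_prod card_bool card_ord.
apply: (@avoids_lt_ramsey _ g); first by move=> u v; rewrite /g eq_sym.
move=> b u v _; rewrite ltnNge => /negP[].
apply: leq_trans (_ : #|(fun i : 'I_n => (u.1 (+) ~~ b, i)) @: 'I_n| <= n).
  apply/subset_leq_card/subsetP => -[x i]; rewrite inE => /andP[_ /eqP <-].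
  apply/imsetP; exists i => //; rewrite /g /=.
  by case: (u.1); case: x.
by apply: leq_trans (leq_imset_card _ _) _; rewrite card_ord.
Qed.

(** A red component has at most [n + m + 1] vertices, one too few. A blue edge has an end in the
    large clique, of blue degree at most [m], too small for either centre since [m <= n]. *)
Lemma ramsey_double_star_gt_n2m n m : m <= n ->
  n + 2 * m + 1 < ramsey (double_star n m).
Proof.
move=> mn; pose T := ('I_(n + m + 1) + 'I_m)%type.
pose side (u : T) := if u is inl _ then true else false.
pose g : rel T := fun u v => side u == side v.
have -> : n + 2 * m + 1 = #|{: T}| by rewrite card_sum !card_ord; lia.
apply: (@avoids_lt_ramsey _ g); first by move=> u v; rewrite /g eq_sym.
have card_side b : #|[set u : T | side u == b]| <= if b then n + m + 1 else m.
  case: b.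
    apply: leq_trans (_ : #|[set (inl i : T) | i : 'I_(n + m + 1)]| <= _).
      by apply/subset_leq_card/subsetP => -[i|i]; rewrite inE //= imset_f.
    by apply: leq_trans (leq_imset_card _ _) _; rewrite card_ord.
  apply: leq_trans (_ : #|[set (inr i : T) | i : 'I_m]| <= _).
    by apply/subset_leq_card/subsetP => -[i|i]; rewrite inE //= imset_f.
  by apply: leq_trans (leq_imset_card _ _) _; rewrite card_ord.
have nbE b u : colour_nbhd g b u \subset [set v | side v == (side u (+) ~~ b)].
  apply/subsetP => v; rewrite !inE /g => /andP[_ /eqP <-].
  by case: (side u); case: (side v).
move=> [|] u v; rewrite !inE => /andP[_ /eqP guv] du dv.
  have su : side u == side v by [].
  apply: leq_trans (_ : #|[set w : T | side w == side u]| <= _).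
    apply/subset_leq_card; rewrite subUset.
    have := nbE true u; have := nbE true v; rewrite !addbF -(eqP su).
    by move=> -> ->.
  by apply: leq_trans (card_side _) _; case: ifP => // _; lia.
have deg_true w : side w -> #|colour_nbhd g false w| <= m.
  move=> sw; apply: leq_trans (subset_leq_card (nbE false w)) _.
  by rewrite sw; exact: card_side false.
case su: (side u); first by have := deg_true u su; lia.
suff sv : side v by have := deg_true v sv; lia.
by move: guv; rewrite /g su; case: (side v).
Qed.

(** The degree hypothesis, stated without subtraction, bounds blue degrees by [n]. The red
    neighbourhoods of a red edge lie over the neighbourhoods of the ends of an edge of [G]. *)
Lemma ramsey_double_star_gt_blowup (G : sgraph) n m k :
  (forall v : G, exists w, adj v w) ->
  (forall v : G, k * #|G| <= n + k * (#|neighborhood v| + 1)) ->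
  (forall u v : G, adj u v ->
    k * #|neighborhood v :|: neighborhood u| <= n + m + 1) ->
  k * #|G| < ramsey (double_star n m).
Proof.
move=> no_isolated min_deg union.
pose g : rel (G * 'I_k) := fun u v => (u.1 == v.1) || adj u.1 v.1.
have -> : k * #|G| = #|{: G * 'I_k}| by rewrite card_prod card_ord mulnC.
apply: (@avoids_lt_ramsey _ g).
  by move=> u v; rewrite /g eq_sym adj_sym.
have vN (v : G) : v \notin neighborhood v by rewrite inE adj_irr.
have card_setXk (A : {set G}) : #|setX A [set: 'I_k]| = k * #|A|.
  by rewrite cardsX cardsT card_ord mulnC.
have nb_true u : colour_nbhd g true u \subset
    setX (u.1 |: neighborhood u.1) [set: 'I_k].
  apply/subsetP => v; rewrite !inE andbT /g => /andP[_ /eqP].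
  by rewrite (eq_sym u.1).
have nb_false u : #|colour_nbhd g false u| <= n.
  have : colour_nbhd g false u \subset
      setX (~: (u.1 |: neighborhood u.1)) [set: 'I_k].
    apply/subsetP => v; rewrite !inE andbT /g => /andP[_ /eqP/negbT].
    by rewrite (eq_sym u.1).
  move=> /subset_leq_card/leq_trans; apply.
  have := min_deg u.1; rewrite card_setXk.
  by rewrite -(cardsC (u.1 |: neighborhood u.1)) cardsU1 vN mulnDr; lia.
move=> [|] u v uv du dv; last by have := nb_false u; lia.
(* The red neighbours of [u] and [v] lie over those of the ends of an edge of
   [G]: [u.1] and [v.1], or [u.1] and any neighbour when [u.1 = v.1]. *)
have [w [uw vw]] : exists w, adj u.1 w /\
    (v.1 \in u.1 |: neighborhood u.1 -> v.1 != u.1 -> w = v.1).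
  have [<-|vu] := eqVneq v.1 u.1.
    by have [w uw] := no_isolated v.1; exists w.
  have : v.1 \in u.1 |: neighborhood u.1.
    by have := subsetP (nb_true u) _ uv; rewrite inE => /andP[].
  by rewrite in_setU1 (negPf vu) inE /= => uv'; exists v.1.
apply: leq_trans (union _ _ uw); rewrite -card_setXk.
apply/subset_leq_card; rewrite subUset.
have sub1 : u.1 |: neighborhood u.1 \subset neighborhood w :|: neighborhood u.1.
  by rewrite setSU // sub1set inE adj_sym.
rewrite (subset_trans (nb_true u)) ?setXS //=.
apply: subset_trans (nb_true v) _; apply: setXS => //.
have [->//|vu] := eqVneq v.1 u.1.
rewrite -vw //; last first.
  by have := subsetP (nb_true u) _ uv; rewrite inE => /andP[].
by rewrite setUC setUS // sub1set inE.
Qed.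

From mathcomp Require Import all_classical all_reals all_analysis.
Import numFieldNormedType.Exports.

Local Open Scope classical_set_scope.
Local Open Scope ring_scope.

(** * From a colouring to a directly valid point *)

Lemma directly_valid_of_not_arrows (R : realType) n m N (delta eta : R) :
  (0 < n)%N -> (2 * n + 2 <= N)%N -> (n + 2 * m + 2 <= N)%N ->
  ~~ arrows (double_star n m) N ->
  0 <= delta -> 0 <= eta ->
  n%:R <= (1 - delta) * N%:R -> (n + m + 1)%:R <= (1 - eta) * N%:R ->
  directly_valid (delta, eta).
Proof.
move=> n0 leN1 leN2 /not_arrows_avoids[g gsym avg] d0 h0 leN3 leN4.
have N0 : 0 < N%:R :> R by rewrite ltr0n; lia.
have le1 (a : R) k : k%:R <= (1 - a) * N%:R -> a <= 1.
  move=> h; rewrite -subr_ge0 -(pmulr_lge0 _ N0).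
  exact: le_trans h.
have cN : #|{: 'I_N}| = N by rewrite card_ord.
(* Few neighbours in the other colour means degree above both [n] and [m] in colour [b], so the
   bound in [avoids] applies to every edge of colour [b]. *)
have [||b maxb] := avoids_max_degree gsym avg n0; rewrite ?cN //.
have dE v := card_colour_nbhd g b v.
split=> /=; first by rewrite d0 (le1 _ _ leN3).
  by rewrite h0 (le1 _ _ leN4).
have cG : #|colour_graph b gsym| = N := cN.
exists (colour_graph b gsym); split; rewrite ?cG.
- by lia.
- move=> v; rewrite neighborhood_colour_graph.
  have : (N <= #|colour_nbhd g b v| + 1 + n)%N.
    by have := maxb v; have := dE v; rewrite cN; lia.
  rewrite -(ler_nat R) !natrD; lra.
- move=> u v uv; rewrite !neighborhood_colour_graph.
  apply: le_trans leN4; rewrite ler_nat finset.setUC; apply: avg => //.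
    by have := maxb u; have := dE u; rewrite cN; lia.
  by have := maxb v; have := dE v; rewrite cN; lia.
Qed.

(** * The set of valid points *)

Section ValidPoints.
Variable R : realType.

Lemma validP (a b : R) : valid (a, b) <-> forall e, 0 < e ->
  exists a' b', [/\ directly_valid (a', b'), `|a - a'| < e & `|b - b'| < e].
Proof.
split=> [vab e e0|vab B].
  have [|[a' b'] [dv [/= Ba Bb]]] := vab (ball ((a, b) : R * R) e).
    exact: nbhsx_ballx.
  by exists a', b'.
move=> /nbhs_ballP[e /= e0 eB]; have [a' [b' [dv Ba Bb]]] := vab e e0.
by exists (a', b'); split=> //; exact: eB.
Qed.

(** When [a > 1/2], no vertex is isolated, and on an edge the union exceeds a single degree by at
    least one, hence has at least [a * #|G|] points. The edgeless graph on two vertices shows why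
    [a <= 1/2] is an exception. *)
Lemma directly_valid_region (a b : R) : directly_valid (a, b) ->
  a <= 2^-1 \/ a + b <= 1.
Proof.
move=> [/= /andP[a0 a1] /andP[b0 b1] [G [G1 mindeg union]]].
have [|a2] := leP a 2^-1; [by left|right].
have G0 : 0 < #|G|%:R :> R by rewrite ltr0n; lia.
have G2 : 2 <= #|G|%:R :> R by rewrite ler_nat.
have /card_gt0P[v _] : (0 < #|G|)%N by lia.
have /card_gt0P[w] : (0 < #|neighborhood v|)%N.
  by rewrite -(ltr_nat R); have := mindeg v; nra.
rewrite inE => vw.
have := card_neighborhoodU (etrans (adj_sym w v) vw).
rewrite -(ler_nat R) -natr1 => le_union.
have := mindeg v; have := union _ _ vw; nra.
Qed.

Lemma valid_region (a b : R) : valid (a, b) ->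
  [/\ 0 <= b <= 1 & a <= 2^-1 \/ a + b <= 1].
Proof.
move=> /validP vab; split.
  apply/andP; split; rewrite leNgt; apply/negP => hb.
    have [|a' [b' [[/= _ /andP[b0 b1] _] _]]] := vab (- b).
      by rewrite oppr_gt0.
    by rewrite ltr_distlC; lra.
  have [|a' [b' [[/= _ /andP[b0 b1] _] _]]] := vab (b - 1).
    by rewrite subr_gt0.
  by rewrite ltr_distlC; lra.
have [|a2] := leP a 2^-1; [by left|right].
rewrite leNgt; apply/negP => hab.
(* Any point within [e] of [(a, b)] still violates both alternatives. *)
pose e := Num.min (a - 2^-1) ((a + b - 1) / 2).
have [|a' [b' [/directly_valid_region dv]]] := vab e.
  by rewrite lt_min; apply/andP; split; lra.
have e1 : e <= a - 2^-1 by rewrite ge_min lexx.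
have e2 : e <= (a + b - 1) / 2 by rewrite ge_min lexx orbT.
by rewrite !ltr_distlC; lra.
Qed.

Lemma rhat'_set_itv (x r : R) : 1 <= x -> rhat'_set x r ->
  x + 1 <= r <= 2 * x + 1.
Proof.
move=> x1 [r0 /valid_region[/andP[h0 h1] h2]].
have r_gt0 : 0 < r.
  rewrite lt_neqAle eq_sym r0 leNgt; apply/negP => rlt0.
  have : 0 < (x + 1) / - r by apply: divr_gt0; lra.
  by rewrite invrN mulrN; lra.
have r1 : (x + 1) / r <= 1 by lra.
rewrite ler_pdivrMr // mul1r in r1; rewrite r1 /=.
case: h2 => h2.
  have : 2^-1 <= x / r by lra.
  by rewrite ler_pdivlMr //; lra.
have : 1 <= (2 * x + 1) / r.
  by rewrite (_ : 2 * x + 1 = x + (x + 1)) ?mulrDl; lra.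
by rewrite ler_pdivlMr //; lra.
Qed.

(** Nonemptiness of the set: for [r = x + 1] the second coordinate is 0, and [K2] satisfies every
    such condition. *)
Lemma rhat'_set_x1 (x : R) : 1 <= x -> rhat'_set x (x + 1).
Proof.
move=> x1; have x1_neq0 : x + 1 != 0 by rewrite gt_eqF //; lra.
split=> //; apply: subset_closure; rewrite divff // subrr.
have le1 : x / (x + 1) <= 1 by rewrite ler_pdivrMr; lra.
have ge0 : 0 <= x / (x + 1) by rewrite divr_ge0; lra.
split=> /=; [lra|lra|].
pose K2 (u v : bool) := u != v.
have K2_sym : symmetric K2 by move=> u v; rewrite /K2 eq_sym.
have K2_irr : irreflexive K2 by move=> u; rewrite /K2 eqxx.
exists (SGraph K2_sym K2_irr).
have cK2 : #|SGraph K2_sym K2_irr| = 2 by exact: card_bool.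
split; rewrite cK2 //.
- move=> v; have -> : neighborhood v = [set ~~ v]%SET.
    by apply/setP => u; rewrite !inE /= /K2; case: u; case: v.
  by rewrite cards1; lra.
- move=> u v _; rewrite subr0 mul1r ler_nat.
  by rewrite -[X in (_ <= X)%N]cK2 max_card.
Qed.

Lemma dist_div_le (y r s : R) : 0 <= y -> y <= r -> 1 <= r -> r <= s ->
  `|(1 - y / s) - (1 - y / r)| <= s - r.
Proof.
move=> y0 yr r1 rs; have r0 : 0 < r by lra.
have s0 : 0 < s by lra.
have -> : (1 - y / s) - (1 - y / r) = (y / r) * ((s - r) / s).
  by field; rewrite !gt_eqF.
have y1 : y / r <= 1 by rewrite ler_pdivrMr // mul1r.
have y2 : 0 <= y / r by rewrite divr_ge0 // ltW.
have s1 : (s - r) / s <= s - r by rewrite ler_pdivrMr //; nra.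
have s2 : 0 <= (s - r) / s by apply: divr_ge0; lra.
rewrite ger0_norm; last exact: mulr_ge0.
by apply: le_trans s1; exact: ler_piMl.
Qed.

(** The set is nonempty and bounded, and its supremum belongs to it because [valid] is closed and
    the point depends on [r] in a Lipschitz way. *)
Lemma rhat'_set_max (x : R) : 1 <= x ->
  exists rhat', is_max (rhat'_set x) rhat'.
Proof.
move=> x1; have in_itv r := @rhat'_set_itv x r x1.
have ubS : ubound (rhat'_set x) (2 * x + 1) by move=> r /in_itv/andP[].
have supS : has_sup (rhat'_set x).
  by split; [exists (x + 1); exact: rhat'_set_x1|exists (2 * x + 1)].
have ub_sup : ubound (rhat'_set x) (sup (rhat'_set x)) := sup_upper_bound supS.
exists (sup (rhat'_set x)); split=> //; set s := sup _ in ub_sup *.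
have s1 : x + 1 <= s by apply/ub_sup/rhat'_set_x1.
split; first by rewrite gt_eqF //; lra.
apply/validP => e e0; have e2 : 0 < e / 2 by lra.
have [r Sr rs] := sup_adherent e2 supS.
have /andP[r1 _] := in_itv _ Sr; have rles := ub_sup _ Sr.
have [_ /validP/(_ _ e2)[a' [b' [dv Ba Bb]]]] := Sr.
exists a', b'; split=> //.
  have := @dist_div_le x r s; rewrite -/s in rs.
  move=> /(_ ltac:(lra) ltac:(lra) ltac:(lra) rles) h.
  by apply: le_lt_trans (ler_distD (1 - x / r) _ _) _; lra.
have := @dist_div_le (x + 1) r s; rewrite -/s in rs.
move=> /(_ ltac:(lra) ltac:(lra) ltac:(lra) rles) h.
by apply: le_lt_trans (ler_distD (1 - (x + 1) / r) _ _) _; lra.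
Qed.

End ValidPoints.

(** * The limit *)

Section Limit.
Variables (R : realType) (x : R).

Let rho (p : nat * nat) : nat := ramsey (double_star p.1 p.2).

(** [K] stands for the additive constants, which the slack [e * p.2] absorbs once [p.2] is large. *)
Lemma ratio_to_near (e K : R) : 0 < e ->
  \forall p \near ratio_to x, [/\ (0 < p.2)%N, (p.2 <= p.1)%N,
    K <= e * p.2%:R & (x - e) * p.2%:R <= p.1%:R <= (x + e) * p.2%:R].
Proof.
move=> e0; pose M := (Num.truncn (`|K| / e)).+1.
exists e => //; exists (setT, [set m | (M <= m)%N]).
  by split=> /=; [exact: filterT|exists M].
move=> [n m] [/= _ leM] mn dist.
have m0 : 0 < m%:R :> R by rewrite ltr0n; lia.
have Ke0 : 0 <= `|K| / e by rewrite divr_ge0 // ltW.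
split=> //; first by lia.
  have /andP[_ ltM] := truncn_itv Ke0.
  have : `|K| / e <= m%:R by apply: le_trans (ltW ltM) _; rewrite ler_nat.
  rewrite ler_pdivrMr // mulrC; apply: le_trans; exact: ler_norm.
move: dist; rewrite ltr_distl => /andP[h1 h2].
by rewrite -ler_pdivlMr // (ltW h1) -ler_pdivrMr // ltW.
Qed.

(** Otherwise some [N] close to [L * m] is not arrowed, which yields a directly valid point within
    [t] of a point that is not valid. *)
Lemma ramsey_near_le (L : R) : 1 <= x -> 2 * x < L -> x + 2 < L -> ~ rhat'_set x L ->
  \forall p \near ratio_to x, (rho p)%:R <= L * p.2%:R.
Proof.
move=> x1 L1 L2 LS; have L0 : 0 < L by lra.
have L_neq0 : L != 0 by rewrite gt_eqF.
have := contra_not (fun v => conj L_neq0 v) LS => {LS} notv.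
have [t t0 nodv] : exists2 t : R, 0 < t & forall a b, directly_valid (a, b) ->
    `|(1 - x / L) - a| < t -> `|(1 - (x + 1) / L) - b| < t -> False.
  apply: contrapT => noT; apply: notv; apply/validP => t t0.
  apply: contrapT => nodv; apply: noT; exists t => // a b dv Ba Bb.
  by apply: nodv; exists a, b.
have xL : (x + 1) / L < 1 by rewrite ltr_pdivrMr // mul1r; lra.
have xL1 : x / L + L^-1 = (x + 1) / L by rewrite mulrDl mul1r.
have iL0 : 0 < L^-1 by rewrite invr_gt0.
(* The point is shifted down by [d] to absorb rounding: [d < t] keeps it in the excluded
   neighbourhood, the second bound keeps its coordinates nonnegative. *)
pose d := Num.min (t / 2) (1 - (x + 1) / L).
have d0 : 0 < d by rewrite lt_min; apply/andP; split; lra.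
have dt : d <= t / 2 by rewrite ge_min lexx.
have dxL : d <= 1 - (x + 1) / L by rewrite ge_min lexx orbT.
have xL0 : 0 < x / L by apply: divr_gt0; lra.
(* The three bounds on [h] serve respectively [2n + 2 <= N], [n + 2m + 2 <= N] and the error [h * m]
   in [n], paid for by [d * L * m]. *)
pose h := Num.min ((L - 2 * x) / 4) (Num.min ((L - (x + 2)) / 4) (d * L / 2)).
have h0 : 0 < h.
  by rewrite !lt_min; apply/and3P; split; [lra|lra|apply: divr_gt0 => //; nra].
have h1 : h <= (L - 2 * x) / 4 by rewrite ge_min lexx.
have h2 : h <= (L - (x + 2)) / 4 by rewrite !ge_min lexx orbT.
have h3 : h <= d * L / 2 by rewrite !ge_min lexx !orbT.
apply: filterS (ratio_to_near 4 h0) => -[n m] /= [m0 mn hm /andP[_ len]].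
have m_gt0 : 0 < m%:R :> R by rewrite ltr0n.
have Lm0 : 0 <= L * m%:R by rewrite mulr_ge0 // ltW.
pose N := Num.truncn (L * m%:R).
have /andP[leN ltN] := truncn_itv Lm0; rewrite -/N -natr1 in leN ltN.
have m1 := ler_wpM2r (ltW m_gt0) h1.
have m2 := ler_wpM2r (ltW m_gt0) h2.
have m3 := ler_wpM2r (ltW m_gt0) h3.
have n0 : (0 < n)%N by exact: leq_trans m0 mn.
have leN1 : (2 * n + 2 <= N)%N.
  by rewrite -ltnS -(ltr_nat R) -natr1 natrD natrM; lra.
have leN2 : (n + 2 * m + 2 <= N)%N.
  by rewrite -ltnS -(ltr_nat R) -natr1 2!natrD natrM; lra.
have [arrN|/negP narrN] := pselect (arrows (double_star n m) N).
  apply: le_trans leN; rewrite ler_nat /rho /ramsey.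
  by case: ex_minnP => k _; apply.
exfalso.
have LmE y : (y / L + d) * (L * m%:R - 1) =
    y * m%:R + d * L * m%:R - (y / L + d).
  by field.
have leLm y : 0 <= y -> (y / L + d) * (L * m%:R - 1) <= (y / L + d) * N%:R.
  move=> y0; apply: ler_wpM2l; last by lra.
  by rewrite addr_ge0 ?divr_ge0 // ltW.
apply: (nodv (1 - (x / L + d)) (1 - ((x + 1) / L + d))).
- apply: directly_valid_of_not_arrows n0 leN1 leN2 narrN _ _ _ _.
  + lra.
  + lra.
  + rewrite subKr; apply: le_trans (leLm x _); last by lra.
    by rewrite LmE; lra.
  + rewrite subKr; apply: le_trans (leLm (x + 1) _); last by lra.
    by rewrite LmE 2!natrD; lra.
- by rewrite (_ : _ - _ = d) ?gtr0_norm //; [lra|ring].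
- by rewrite (_ : _ - _ = d) ?gtr0_norm //; [lra|ring].
Qed.

Lemma ramsey_near_ge_2x (e : R) : 0 < e ->
  \forall p \near ratio_to x, (2 * x - e) * p.2%:R <= (rho p)%:R.
Proof.
move=> e0; have e2 : 0 < e / 2 by lra.
apply: filterS (ratio_to_near 0 e2) => -[n m] /= [m0 mn _ /andP[len _]].
apply: le_trans (_ : (2 * n)%:R <= _); first by rewrite natrM; lra.
by rewrite ler_nat ltnW // ramsey_double_star_gt_2n.
Qed.

Lemma ramsey_near_ge_x2 (e : R) : 0 < e ->
  \forall p \near ratio_to x, (x + 2 - e) * p.2%:R <= (rho p)%:R.
Proof.
move=> e0.
apply: filterS (ratio_to_near 0 e0) => -[n m] /= [m0 mn _ /andP[len _]].
apply: le_trans (_ : (n + 2 * m + 1)%:R <= _).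
  by rewrite 2!natrD natrM; lra.
by rewrite ler_nat ltnW // ramsey_double_star_gt_n2m.
Qed.

(** A directly valid point near that of [r] gives a graph to blow up; [2 * x < r] puts its first
    coordinate above 1/2, which excludes isolated vertices. *)
Lemma ramsey_near_ge_rhat' (r e : R) : 1 <= x -> rhat'_set x r -> 2 * x < r ->
  0 < e <= 1 -> \forall p \near ratio_to x, (r - e) * p.2%:R <= (rho p)%:R.
Proof.
move=> x1 [_ /validP vr] xr /andP[e0 e1].
have r0 : 0 < r by lra.
have x0 : 0 < x by lra.
have xr2 : x / r < 2^-1 by rewrite ltr_pdivrMr; lra.
have xr0 : 0 < x / r by rewrite divr_gt0.
(* Replacing [r] by [r - e / 2] gains [2 * c]: one [c] pays for the distance [t] to the directly
   valid point, the other for the deviation of [n / m] from [x]. *)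
pose c := e * (x / r) / 4.
have c0 : 0 < c by rewrite divr_gt0 // mulr_gt0.
pose t := Num.min (2^-1 - x / r) (c / r).
have t0 : 0 < t by rewrite lt_min divr_gt0 // andbT; lra.
have t1 : t <= 2^-1 - x / r by rewrite ge_min lexx.
have t2 : t * r <= c by rewrite -ler_pdivlMr // ge_min lexx orbT.
have [a [b [[/= /andP[_ a1] /andP[_ b1] [G [G1 mindeg union]]] Ba Bb]]] := vr _ t0.
rewrite ltr_distlC in Ba; rewrite ltr_distlC in Bb.
have G0 : 0 < #|G|%:R :> R by rewrite ltr0n ltnW.
have G2 : 2 <= #|G|%:R :> R by rewrite ler_nat.
pose r1 := r - e / 2.
have r1_ge0 : 0 <= r1 by rewrite /r1; lra.
have r1a : r1 * (1 - a) <= x - c.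
  have : r1 * (1 - a) <= r1 * (x / r + t) by rewrite ler_wpM2l //; lra.
  have -> : r1 * (x / r + t) = x - 2 * c + r1 * t.
    by rewrite /r1 /c; field; rewrite gt_eqF.
  have : r1 * t <= t * r by rewrite mulrC ler_wpM2l ?ltW // /r1; lra.
  lra.
have r1b : r1 * (1 - b) <= x + 1 - c.
  have : r1 * (1 - b) <= r1 * ((x + 1) / r + t) by rewrite ler_wpM2l //; lra.
  have -> : r1 * ((x + 1) / r + t) = x + 1 - 2 * c - e / 2 / r + r1 * t.
    by rewrite /r1 /c; field; rewrite gt_eqF.
  have : r1 * t <= t * r by rewrite mulrC ler_wpM2l ?ltW // /r1; lra.
  have : 0 <= e / 2 / r by rewrite !divr_ge0 // ltW.
  lra.
pose h := Num.min c (e / 2).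
have h0 : 0 < h by rewrite lt_min c0 /=; lra.
have hc : h <= c by rewrite ge_min lexx.
have he : h <= e / 2 by rewrite ge_min lexx orbT.
apply: filterS (ratio_to_near #|G|%:R h0) => -[n m] /= [m0 mn hm /andP[len _]].
have m_gt0 : 0 < m%:R :> R by rewrite ltr0n.
have q0 : 0 <= r1 * m%:R / #|G|%:R by rewrite !mulr_ge0 ?invr_ge0 // ltW.
(* Clique size for a blow-up on about [r1 * m] vertices; rounding loses less than
   [#|G| <= e / 2 * m]. *)
pose k := Num.truncn (r1 * m%:R / #|G|%:R).
have /andP[lek ltk] := truncn_itv q0; rewrite -/k in lek ltk.
rewrite ler_pdivlMr // in lek; rewrite ltr_pdivrMr // -natr1 in ltk.
have a2 : 2^-1 < a by lra.
have hcm := ler_wpM2r (ltW m_gt0) hc.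
have hem := ler_wpM2r (ltW m_gt0) he.
have k_le y z : 0 <= y -> r1 * y <= z -> k%:R * #|G|%:R * y <= z * m%:R.
  move=> y0 r1y; apply: le_trans (ler_wpM2r y0 lek) _.
  by rewrite mulrAC ler_wpM2r // ltW.
apply: le_trans (_ : (k * #|G|)%:R <= _).
  by rewrite natrM; rewrite /r1 in ltk; lra.
rewrite ler_nat ltnW //; apply: ramsey_double_star_gt_blowup.
- move=> v; have /card_gt0P[w] : (0 < #|neighborhood v|)%N.
    by rewrite -(ltr_nat R); have := mindeg v; nra.
  by rewrite inE; exists w.
- move=> v; rewrite -(ler_nat R) natrD !natrM natrD.
  have := k_le (1 - a) _ _ r1a; rewrite subr_ge0 => /(_ a1).
  have := ler_wpM2l (ler0n R k) (mindeg v).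
  lra.
- move=> u v uv; rewrite -(ler_nat R) natrM !natrD.
  have := k_le (1 - b) _ _ r1b; rewrite subr_ge0 => /(_ b1).
  have := ler_wpM2l (ler0n R k) (union _ _ uv).
  lra.
Qed.

End Limit.

Theorem theorem4p3 (R : realType) (x : R) (hx : 1 <= x) :
  exists2 rhat' : R, is_max (rhat'_set x) rhat' &
    (ramsey (double_star p.1 p.2))%:R / p.2%:R @[p --> ratio_to x]
      --> Num.max (2 * x) (Num.max (x + 2) rhat').
Proof.
have [r [Sr ub_r]] := rhat'_set_max hx; exists r => //.
set L := Num.max _ _.
have L1 : 2 * x <= L by rewrite le_max lexx.
have L2 : x + 2 <= L by rewrite !le_max lexx orbT.
have L3 : r <= L by rewrite !le_max lexx !orbT.
apply/cvgrPdist_le => eps eps0; pose e := Num.min eps 1.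
have e0 : 0 < e by rewrite lt_min eps0 ltr01.
have e1 : e <= 1 by rewrite ge_min lexx orbT.
have e_eps : e <= eps by rewrite ge_min lexx.
have upper : \forall p \near ratio_to x,
    (ramsey (double_star p.1 p.2))%:R <= (L + e) * p.2%:R.
  apply: ramsey_near_le => //; [lra|lra|].
  (* [L + e] exceeds the maximum [r], so it cannot lie in [rhat'_set x]. *)
  by move=> /ub_r; lra.
have lower : \forall p \near ratio_to x,
    (L - e) * p.2%:R <= (ramsey (double_star p.1 p.2))%:R.
  (* A tie [r = 2 * x] is assigned to the two-clique bound, so the blow-up is used only under the
     strict inequality it requires. *)
  have [->|[->|[-> xr]]] : L = 2 * x \/ L = x + 2 \/ L = r /\ 2 * x < r.
    rewrite /L; case: (lerP (x + 2) r) => xr.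
      have [h|h|h] := ltgtP (2 * x) r; first by right; right.
        by left.
      by left.
    by case: (lerP (2 * x) (x + 2)) => h; [right; left|left].
  - exact: ramsey_near_ge_2x.
  - exact: ramsey_near_ge_x2.
  - by apply: ramsey_near_ge_rhat' => //; rewrite e0.
have pos := @ratio_to_near R x e 0 e0.
apply: filterS3 upper lower pos => -[n m] /= up lo [m0 _ _ _].
have m_gt0 : 0 < m%:R :> R by rewrite ltr0n.
rewrite ler_distlC ler_pdivlMr // ler_pdivrMr //; apply/andP; split.
  by apply: le_trans lo; rewrite ler_wpM2r ?ler0n // lerB.
by apply: le_trans up _; rewrite ler_wpM2r ?ler0n // lerD2l.
Qed.
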